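(* Let $\sigma^1_{\alpha,\beta,\gamma}$ and $\sigma^2_{\alpha,\beta,\gamma}$ be the unified generalized $q$-Stirling matrices with real parameters $\alpha$, $\beta$, and $\gamma$. Then $$\sigma^1_{\alpha,\beta,\gamma}=\sigma^1_{\alpha,0,0}\,\sigma^1_{0,0,\gamma}\,\sigma^1_{0,\beta,0}$$ and $$\sigma^2_{\alpha,\beta,\gamma}=\sigma^2_{0,\beta,0}\,\sigma^2_{0,0,\gamma}\,\sigma^2_{\alpha,0,0}.$$
   Context: Fix a real number $q>0$, $q\neq 1$. For numbers $a$ and an integer $n\ge0$ let $[t|a]_n=\prod_{j=0}^{n-1}(t-a^j)$, $[t|a]_0=1$. For real or complex $a,b,c$ the exponential-type Stirling numbers $S[n,k;a,b,c]$ ($n,k\ge 0$, with $S[n,k;a,b,c]=0$ for $k>n$) are defined by the polynomial identities in $t$ $$[t|a]_n=\sum_{k=0}^{n}S[n,k;a,b,c]\,[t-c|b]_k,\qquad n\ge 0.$$ The unified generalized $q$-Stirling numbers are $$\sigma^1[n,k;\alpha,\beta,\gamma]_q=S[n,k;q^\alpha,q^\beta,q^\gamma-1]\,(q-1)^{k-n},\qquad \sigma^2[n,k;\alpha,\beta,\gamma]_q=S[n,k;q^\beta,q^\alpha,1-q^\gamma]\,(q-1)^{k-n}.$$ The unified generalized $q$-Stirling matrices $\sigma^1_{\alpha,\beta,\gamma}$ and $\sigma^2_{\alpha,\beta,\gamma}$ are the infinite lower triangular matrices, with rows and columns indexed by $n,k=0,1,2,\ldots$, whose $(n,k)$ entries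 are $\sigma^1[n,k;\alpha,\beta,\gamma]_q$ and $\sigma^2[n,k;\alpha,\beta,\gamma]_q$ respectively (zero for $k>n$). Products of infinite lower triangular matrices are well defined since each row has finitely many nonzero entries. *)

(* Defs.v *)
From HB Require Import structures.
From mathcomp Require Import all_boot all_order all_algebra.
From mathcomp Require Import boolp reals exp.
Set Implicit Arguments.
Unset Strict Implicit.
Unset Printing Implicit Defensive.
Import Order.TTheory GRing.Theory Num.Theory.
Local Open Scope ring_scope.

(* [t | a]_n, as a polynomial in t = 'X; the shifted [t - c | b]_k is
   [bracket b k \Po ('X - c%:P)]. *)
Definition bracket (F : fieldType) (a : F) (n : nat) : {poly F} :=
  \prod_(j < n) ('X - (a ^+ j)%:P).

Definition is_expStirling (F : fieldType) (a b c : F) (S : nat -> nat -> F) :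
    Prop :=
  (forall n k : nat, (n < k)%N -> S n k = 0) /\
  (forall n : nat,
     bracket a n = \sum_(k < n.+1) S n k *: (bracket b k \Po ('X - c%:P))).

Section ExpStirlingExists.
Context {F : fieldType}.
Implicit Types (a b c : F) (p : {poly F}).

Lemma bracket_compE b c k :
  bracket b k \Po ('X - c%:P) = \prod_(j < k) ('X - (c + b ^+ j)%:P).
Proof.
rewrite /bracket rmorph_prod; apply: eq_bigr => j _ /=.
by rewrite comp_polyB comp_polyX comp_polyC polyCD opprD addrA.
Qed.

Lemma size_bracket a n : size (bracket a n) = n.+1.
Proof. by rewrite /bracket -big_enum size_prod_XsubC size_enum_ord. Qed.

Lemma size_bracket_comp b c k : size (bracket b k \Po ('X - c%:P)) = k.+1.
Proof.
by rewrite bracket_compE -big_enum size_prod_XsubC size_enum_ord.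
Qed.

Lemma coef_bracket_comp b c k : (bracket b k \Po ('X - c%:P))`_k = 1.
Proof.
have := monic_prod_XsubC (index_enum 'I_k) predT (fun j : 'I_k => c + b ^+ j).
by rewrite -bracket_compE monicE /lead_coef size_bracket_comp /= => /eqP.
Qed.

Lemma bracket_span b c n p : (size p <= n)%N ->
  exists s : nat -> F, p = \sum_(k < n) s k *: (bracket b k \Po ('X - c%:P)).
Proof.
elim: n p => [|n IHn] p sp.
  exists (fun=> 0); rewrite big_ord0; apply/eqP.
  by rewrite -size_poly_eq0 -leqn0.
set B := bracket b n \Po ('X - c%:P).
have [|s ps] := IHn (p - p`_n *: B).
  apply/leq_sizeP => j; rewrite leq_eqVlt coefB coefZ => /predU1P[<-|nj].
    by rewrite coef_bracket_comp mulr1 subrr.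
  rewrite [p`_j]nth_default ?(leq_trans sp) //.
  by rewrite [B`_j]nth_default ?size_bracket_comp // mulr0 subrr.
exists (fun k => if k == n then p`_n else s k).
rewrite big_ord_recr /= eqxx -/B -[LHS](subrK (p`_n *: B)) ps.
by congr (_ + _); apply: eq_bigr => i _; rewrite ltn_eqF.
Qed.

Lemma bracket_free b c n (s : nat -> F) :
  \sum_(k < n) s k *: (bracket b k \Po ('X - c%:P)) = 0 ->
  forall k, (k < n)%N -> s k = 0.
Proof.
elim: n => // n IHn; rewrite big_ord_recr /= => s0.
have sn0 : s n = 0.
  have := congr1 (fun p : {poly F} => p`_n) s0.
  rewrite coefD coefZ coef_bracket_comp mulr1 coef0 coef_sum big1 ?add0r //.
  by move=> i _; rewrite coefZ nth_default ?mulr0 // size_bracket_comp.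
move=> k; rewrite ltnS leq_eqVlt => /predU1P[->//|].
by apply: IHn; move: s0; rewrite sn0 scale0r addr0.
Qed.

Lemma is_expStirling_exists a b c : exists S, is_expStirling a b c S.
Proof.
have /choice[s sE] n : exists s : nat -> F, bracket a n =
    \sum_(k < n.+1) s k *: (bracket b k \Po ('X - c%:P)).
  by apply: bracket_span; rewrite size_bracket.
exists (fun n k => if (k <= n)%N then s n k else 0); split=> [n k|n].
  by case: leqP.
rewrite sE; apply: eq_bigr => k _.
by rewrite -ltnS ltn_ord.
Qed.

Lemma is_expStirling_unique a b c S S' :
  is_expStirling a b c S -> is_expStirling a b c S' -> S = S'.
Proof.
move=> [S0 SE] [S'0 S'E]; apply/funext => n; apply/funext => k.
have [nk|kn] := ltnP n k; first by rewrite S0 // S'0.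
apply/eqP; rewrite -subr_eq0; apply/eqP.
apply: (@bracket_free b c n.+1 (fun k => S n k - S' n k)) => //.
under eq_bigr do rewrite scalerBl.
by rewrite sumrB -SE -S'E subrr.
Qed.

End ExpStirlingExists.

Definition expStirling (F : fieldType) (a b c : F) : nat -> nat -> F :=
  sval (cid (is_expStirling_exists a b c)).

Lemma expStirlingP (F : fieldType) (a b c : F) :
  is_expStirling a b c (expStirling a b c).
Proof. by rewrite /expStirling; case: cid. Qed.

Definition infmx (R : realType) : Type := nat -> nat -> R.

Definition lower_triangular (R : realType) (A : infmx R) : Prop :=
  forall n k : nat, (n < k)%N -> A n k = 0.

(* The sum over all j is cut at j = n, which loses nothing when A is lower
   triangular: see [lt_mulmx_trunc]. *)
Definition lt_mulmx (R : realType) (A B : infmx R) : infmx R :=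
  fun n k => \sum_(j < n.+1) A n j * B j k.

Lemma lt_mulmx_trunc (R : realType) (A B : infmx R) (n k m : nat) :
  lower_triangular A -> (n < m)%N ->
  \sum_(j < m) A n j * B j k = lt_mulmx A B n k.
Proof.
move=> A0 nm; rewrite /lt_mulmx [RHS](big_ord_widen m (fun j => A n j * B j k)) //.
rewrite [RHS]big_mkcond; apply: eq_bigr => j _; rewrite ltnS.
by case: leqP => // nj; rewrite A0 // mul0r.
Qed.

(* [`^] is the real power, [^] the integer power: the exponent k - n is
   nonpositive on and below the diagonal. *)
Definition sigma1 (R : realType) (q alpha beta gamma : R) : infmx R :=
  fun n k => expStirling (q `^ alpha) (q `^ beta) (q `^ gamma - 1) n k
             * (q - 1) ^ (k%:Z - n%:Z).

Definition sigma2 (R : realType) (q alpha beta gamma : R) : infmx R :=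
  fun n k => expStirling (q `^ beta) (q `^ alpha) (1 - q `^ gamma) n k
             * (q - 1) ^ (k%:Z - n%:Z).

Lemma sigma1_lower_triangular (R : realType) (q alpha beta gamma : R) :
  lower_triangular (sigma1 q alpha beta gamma).
Proof.
by move=> n k nk; rewrite /sigma1 (expStirlingP _ _ _).1 // mul0r.
Qed.

Lemma sigma2_lower_triangular (R : realType) (q alpha beta gamma : R) :
  lower_triangular (sigma2 q alpha beta gamma).
Proof.
by move=> n k nk; rewrite /sigma2 (expStirlingP _ _ _).1 // mul0r.
Qed.

(* Main.v *)
(* Substituting the expansion of [t - c | b]_k in the basis [t - c - d | e]_j
   into that of [t | a]_n shows that exponential-type Stirling matrices compose:
   S[a, b, c] S[b, e, d] = S[a, e, c + d]. The powers of q - 1 only conjugate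
   by a diagonal matrix, and the three factors chain as
   a -> 1 -> 1 -> b with shifts 0, c, 0. *)
Require Import Defs.
From HB Require Import structures.
From mathcomp Require Import all_boot all_order all_algebra.
From mathcomp Require Import boolp reals exp.
Set Implicit Arguments.
Unset Strict Implicit.
Unset Printing Implicit Defensive.
Import Order.TTheory GRing.Theory Num.Theory.
Local Open Scope ring_scope.

Lemma is_expStirling_mul (F : fieldType) (a b e c d : F)
    (S T : nat -> nat -> F) :
  is_expStirling a b c S -> is_expStirling b e d T ->
  is_expStirling a e (c + d) (fun n k => \sum_(j < n.+1) S n j * T j k).
Proof.
move=> [S0 SE] [T0 TE]; split=> [n k nk|n].
  rewrite big1 // => j _.
  by rewrite T0 ?mulr0 // (leq_ltn_trans _ nk) // -ltnS.
rewrite SE; under [RHS]eq_bigr do rewrite scaler_suml.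
rewrite exchange_big /=; apply: eq_bigr => j _.
have shiftD : ('X - d%:P) \Po ('X - c%:P) = 'X - (c + d)%:P.
  by rewrite comp_polyB comp_polyX comp_polyC polyCD opprD addrA.
rewrite TE linear_sum scaler_sumr /=.
(* The expansion of row [j] stops at [k = j]; extending it to [n] adds only terms with [j < k],
   where [T j k = 0]. *)
rewrite (big_ord_widen n.+1 (fun k => S n j *: ((T j k *:
  (bracket e k \Po ('X - d%:P))) \Po ('X - c%:P)))) ?ltn_ord //.
rewrite big_mkcond; apply: eq_bigr => k _.
rewrite comp_polyZ -comp_polyA shiftD scalerA ltnS.
by case: leqP => // jk; rewrite T0 // mulr0 scale0r.
Qed.

Lemma expStirling_mul (F : fieldType) (a b e c d : F) (n k : nat) :
  \sum_(j < n.+1) expStirling a b c n j * expStirling b e d j k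
  = expStirling a e (c + d) n k.
Proof.
have ST := is_expStirling_mul (expStirlingP a b c) (expStirlingP b e d).
by rewrite -(is_expStirling_unique ST (expStirlingP a e (c + d))).
Qed.

(** Common form of [sigma1] and [sigma2], which differ only in the order of the two bases and the
    sign of the shift. *)
Definition scaled_expStirling (R : realType) (x a b c : R) : infmx R :=
  fun n k => expStirling a b c n k * x ^ (k%:Z - n%:Z).

Lemma scaled_expStirling_mul (R : realType) (x a b e c d : R) : x != 0 ->
  lt_mulmx (scaled_expStirling x a b c) (scaled_expStirling x b e d)
  = scaled_expStirling x a e (c + d).
Proof.
move=> x0; apply/funext => n; apply/funext => k.
rewrite /scaled_expStirling -(expStirling_mul a b) mulr_suml.
(* The exponents telescope: (j - n) + (k - j) = k - n. They may be negative, hence [x != 0]. *)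
apply: eq_bigr => j _; rewrite mulrACA -expfzDr //.
by rewrite addrC addrA subrK.
Qed.

Theorem theorem3p1 (R : realType) (q : R) (q_gt0 : 0 < q) (q_neq1 : q != 1)
    (alpha beta gamma : R) :
  sigma1 q alpha beta gamma
    = lt_mulmx (lt_mulmx (sigma1 q alpha 0 0) (sigma1 q 0 0 gamma))
               (sigma1 q 0 beta 0)
  /\
  sigma2 q alpha beta gamma
    = lt_mulmx (lt_mulmx (sigma2 q 0 beta 0) (sigma2 q 0 0 gamma))
               (sigma2 q alpha 0 0).
Proof.
have q10 : q - 1 != 0 by rewrite subr_eq0.
have sigma1E a b c : sigma1 q a b c =
  scaled_expStirling (q - 1) (q `^ a) (q `^ b) (q `^ c - 1) by [].
have sigma2E a b c : sigma2 q a b c =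
  scaled_expStirling (q - 1) (q `^ b) (q `^ a) (1 - q `^ c) by [].
(* Adjacent bases already agree as the zeroth power of [q]; its value 1 serves only to make the two
   outer shifts 1 - 1 vanish. *)
by split; rewrite ?sigma1E ?sigma2E !scaled_expStirling_mul // powRr0 subrr
  add0r addr0.
Qed.
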